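(* Let $b>1$ be an integer and let $N=p_1^{e_1}p_2^{e_2}\cdots p_l^{e_l}$ be an odd composite number, where $p_1,\dots,p_l$ are distinct primes and $e_1,\dots,e_l\ge 1$, with $\gcd(N,b)=1$. Then $N$ is a Midy pseudoprime to base $b$ if and only if $|b|_N=|b|_{p_i}$ for every $1\le i\le l$.
   Context: Let $b>1$ be an integer (the base of numeration). For a positive integer $M$ with $\gcd(M,b)=1$, $|b|_M$ denotes the multiplicative order of $b$ modulo $M$, i.e. the least positive integer $n$ with $b^n\equiv 1 \pmod M$, and $\mathbb{U}_M$ denotes the set of positive integers less than $M$ and relatively prime to $M$. For $x\in\mathbb{U}_M$, the base-$b$ expansion of $x/M$ is purely periodic with period of length $|b|_M$: $\frac{x}{M}=0.\overline{a_1a_2\cdots a_{|b|_M}}$, with $a_i$ base-$b$ digits. Midy's property: let $|b|_M=dk$ with $d,k$ positive integers and $d>1$. Split the period into $d$ blocks of length $k$, let $A_j=[a_{(j-1)k+1}a_{(j-1)k+2}\cdots a_{jk}]_b$ be the integer represented in base $b$ by the $j$-th block, and let $S_d(x)=\sum_{j=1}^d A_j$. One says $M$ has the Midy's property for $b$ and $d$ if $S_d(x)$ is a multiple of $b^k-1$ for all $x\in\mathbb{U}_M$. The set of all such $d$ (divisors $d>1$ of $|b|_M$ for which $M$ has the Midy's property for $b$ and $d$) is denoted $\mathcal{M}_b(M)$. An integer $M$ is a Midy pseudoprime to base $b$ if $M$ is an odd composite number relatively prime to both $b$ and $|b|_M$, and $d\in\mathcal{M}_b(M)$ for every divisor $d>1$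 of $|b|_M$. *)

(* Defs.v *)
From mathcomp Require Import all_boot cyclic.

Set Implicit Arguments.
Unset Strict Implicit.
Unset Printing Implicit Defensive.

Local Open Scope nat_scope.

Lemma mult_order_subproof (b M : nat) :
  exists n, coprime b M ==> (0 < n) && (b ^ n == 1 %[mod M]).
Proof.
case: (posnP M) => [->|M_gt0].
  exists 1; apply/implyP; rewrite /coprime gcdn0 => /eqP ->; exact: eqxx.
exists (totient M); apply/implyP => co_bM.
by rewrite totient_gt0 M_gt0; apply/eqP/Euler_exp_totient.
Qed.

(* The multiplicative order of b modulo M; it takes the value 0 when b and M
   are not coprime. *)
Definition mult_order (b M : nat) : nat := ex_minn (mult_order_subproof b M).

Lemma mult_orderP (b M : nat) : coprime b M ->
  [/\ 0 < mult_order b M, b ^ mult_order b M = 1 %[mod M]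
    & forall n, 0 < n -> b ^ n = 1 %[mod M] -> mult_order b M <= n].
Proof.
rewrite /mult_order; case: ex_minnP => m + min_m co; rewrite co /=.
case/andP=> m_gt0 /eqP bm; split=> // n n_gt0 bn.
by apply: min_m; rewrite co n_gt0 bn /=.
Qed.

Definition composite (M : nat) : bool := (1 < M) && ~~ prime M.

(* The i-th digit after the point (i >= 1) of the base b expansion of x / M,
   namely floor (b ^ i * x / M) mod b. *)
Definition digit (b M x i : nat) : nat := (b ^ i * x %/ M) %% b.

Definition unit_residue (M x : nat) : bool :=
  [&& 0 < x, x < M & coprime x M].

(* A_j, the number written a_((j-1)k+1) ... a_(jk) in base b, for j >= 1. *)
Definition block (b M k x j : nat) : nat :=
  \sum_(1 <= i < k.+1) digit b M x (j.-1 * k + i) * b ^ (k - i).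

Definition midy_sum (b M d x : nat) : nat :=
  \sum_(1 <= j < d.+1) block b M (mult_order b M %/ d) x j.

(* Only meaningful when d divides the order of b modulo M; this is required in
   [midy_set]. *)
Definition midy_property (b M d : nat) : Prop :=
  forall x, unit_residue M x ->
    b ^ (mult_order b M %/ d) - 1 %| midy_sum b M d x.

Definition midy_set (b M : nat) (d : nat) : Prop :=
  [/\ 1 < d, d %| mult_order b M & midy_property b M d].

Definition midy_pseudoprime (b M : nat) : Prop :=
  [/\ odd M, composite M, coprime M b, coprime M (mult_order b M)
    & forall d, 1 < d -> d %| mult_order b M -> midy_set b M d].

(* The first n digits of x / M represent floor (b ^ n * x / M). *)
Lemma digit_sum (b M x n : nat) : 0 < b -> x < M ->
  \sum_(1 <= i < n.+1) digit b M x i * b ^ (n - i) = b ^ n * x %/ M.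
Proof.
move=> b_gt0 ltxM; elim: n => [|n IHn].
  by rewrite big_geq // mul1n divn_small.
rewrite big_nat_recr //= subnn muln1.
rewrite (eq_big_nat _ _ (F2 := fun i => b * (digit b M x i * b ^ (n - i)))).
  rewrite -big_distrr /= IHn /digit.
  have -> : b ^ n * x %/ M = (b ^ n.+1 * x %/ M) %/ b.
    by rewrite -divnMA (mulnC M) expnS -mulnA divnMA mulKn.
  by rewrite mulnC -divn_eq.
by move=> i /andP[_ lein]; rewrite subSn // expnS mulnCA.
Qed.

(* x / M = [a_1 ... a_n]_b / (b ^ n - 1), where n is the order of b modulo M:
   the digits repeat the block a_1 ... a_n. *)
Lemma digit_period (b M x : nat) : 1 < b -> coprime b M -> x < M ->
  let n := mult_order b M in
  M * (\sum_(1 <= i < n.+1) digit b M x i * b ^ (n - i)) = x * (b ^ n - 1)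
  /\ forall i, 0 < i -> digit b M x (i + n) = digit b M x i.
Proof.
move=> b_gt1 co_bM ltxM n.
have b_gt0 : 0 < b by apply: ltnW.
have M_gt0 : 0 < M by apply: leq_ltn_trans ltxM.
have bn_gt0 : 0 < b ^ n by rewrite expn_gt0 b_gt0.
have [_ bn _] := mult_orderP co_bM; rewrite -/n in bn.
have dvdM : M %| b ^ n - 1 by rewrite -eqn_mod_dvd //; apply/eqP.
have [q Dq] := dvdnP dvdM.
have Dbn : b ^ n = q * M + 1 by rewrite -Dq subnK.
split.
  rewrite digit_sum // Dq Dbn mulnDl mul1n mulnAC divnMDl // divn_small // addn0.
  by rewrite mulnC mulnAC mulnC.
move=> [//|i] _; rewrite /digit expnD Dbn [q * M + 1]addnC mulnDr muln1 mulnDl.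
have -> : b ^ i.+1 * x + b ^ i.+1 * (q * M) * x
  = b * (b ^ i * q * x) * M + b ^ i.+1 * x.
  by rewrite addnC expnS -!mulnA [M * x]mulnC.
by rewrite divnMDl // [b * _]mulnC modnMDl.
Qed.

(* Main.v *)
Require Import Defs.
From mathcomp Require Import all_boot cyclic.

(** Write [n] for the order of [b] modulo [N], and let [n = d * k].  Since
    [b ^ k] is 1 modulo [b ^ k - 1], the sum of the [d] blocks of the period
    of [x / N] is congruent to the whole period read as one number, which is
    [x * (b ^ n - 1) / N].  Taking [x = 1] then shows that the Midy property
    for [d] amounts to a divisibility that no longer mentions digits
    ([midy_propertyP]): [N] divides the repunit-like quotient
    [(b ^ n - 1) / (b ^ k - 1) = 1 + b ^ k + ... + b ^ (k (d - 1))].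

    Let [N] be a Midy pseudoprime, and suppose that the order [m] of [b] modulo
    a prime [q] dividing [N] is a proper divisor of [n].  Take [k = m]: every
    term of the quotient is 1 modulo [q], so the quotient is [d] modulo [q], and
    [q] divides both [d], hence [n], and [N]; but [N] is coprime to [n].

    Conversely, suppose that the order of [b] is [n] modulo every prime factor
    [q] of [N].  By Fermat [n < q], so [N] is coprime to [n]; and if [k < n],
    no [q] divides [b ^ k - 1], so [N] is coprime to [b ^ k - 1].  As [N]
    divides [b ^ n - 1], Gauss's lemma makes it divide the quotient. *)

Lemma expn_mod1 (b M n k : nat) :
  b ^ n = 1 %[mod M] -> b ^ (n * k) = 1 %[mod M].
Proof. by move=> bn; rewrite expnM -modnXm bn modnXm exp1n. Qed.

Lemma mult_order_dvd (b M n : nat) : coprime b M ->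
  (mult_order b M %| n) = (b ^ n == 1 %[mod M]).
Proof.
move=> co; have [m_gt0 bm min_m] := mult_orderP co.
set m := mult_order b M in m_gt0 bm min_m *.
apply/idP/eqP => [/dvdnP[k ->]|bn]; first by rewrite mulnC; apply: expn_mod1.
have br : b ^ (n %% m) = 1 %[mod M].
  rewrite -bn {2}(divn_eq n m) expnD -modnMml (mulnC (n %/ m)).
  by rewrite (expn_mod1 _ _ _ _ bm) modnMml mul1n.
rewrite /dvdn; case: posnP => // r_gt0.
by have := min_m _ r_gt0 br; rewrite leqNgt ltn_pmod.
Qed.

Lemma mult_order_dvd_subn1 (b M n : nat) : 0 < b -> coprime b M ->
  (mult_order b M %| n) = (M %| b ^ n - 1).
Proof.
by move=> b_gt0 co; rewrite mult_order_dvd // eqn_mod_dvd // expn_gt0 b_gt0.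
Qed.

Lemma mult_order_ltn (b q : nat) : prime q -> coprime b q -> mult_order b q < q.
Proof.
move=> q_pr co; have [_ _ min_m] := mult_orderP co.
have phi_gt0 : 0 < totient q by rewrite totient_gt0 prime_gt0.
apply: leq_ltn_trans (min_m _ phi_gt0 (Euler_exp_totient co)) _.
by rewrite totient_prime // prednK ?prime_gt0.
Qed.

Lemma coprime_prod_primes (l : nat) (p e : 'I_l -> nat) (m : nat) :
  (forall i, prime (p i)) -> (forall i, ~~ (p i %| m)) ->
  coprime (\prod_(i < l) p i ^ e i) m.
Proof.
move=> pr_p ndv; apply: (big_ind (fun x => coprime x m)) => [|x y|i _].
- exact: coprime1n.
- by rewrite coprimeMl => -> ->.
by apply: coprimeXl; rewrite prime_coprime.
Qed.

(** Horner's scheme in base [b ^ k]: appending a block multiplies the number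
    read so far by [b ^ k], which is 1 modulo [b ^ k - 1]. *)
Lemma block_sum_mod (b M k x d : nat) : 0 < b ->
  \sum_(1 <= j < d.+1) block b M k x j
  = \sum_(1 <= i < (d * k).+1) digit b M x i * b ^ (d * k - i)
  %[mod b ^ k - 1].
Proof.
move=> b_gt0; elim: d => [|d IHd]; first by rewrite !big_geq.
have bk : b ^ k = 1 %[mod b ^ k - 1].
  by apply/eqP; rewrite eqn_mod_dvd // expn_gt0 b_gt0.
rewrite big_nat_recr //= [in RHS](big_cat_nat _ (n := (d * k).+1)) //=; last first.
  by rewrite ltnS leq_mul2r leqnSn orbT.
have -> : \sum_(1 <= i < (d * k).+1) digit b M x i * b ^ (d.+1 * k - i)
    = b ^ k * \sum_(1 <= i < (d * k).+1) digit b M x i * b ^ (d * k - i).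
  rewrite big_distrr /=; apply: eq_big_nat => i /andP[_ le_i].
  by rewrite mulSn -addnBA // expnD mulnCA.
have -> : \sum_((d * k).+1 <= i < (d.+1 * k).+1)
      digit b M x i * b ^ (d.+1 * k - i) = block b M k x d.+1.
  rewrite /block -[(d * k).+1]add1n big_addn.
  rewrite (_ : (d.+1 * k).+1 - d * k = k.+1); last first.
    by rewrite mulSn -addSn addnK.
  apply: eq_big_nat => i _; rewrite /= addnC; congr (_ * b ^ _).
  by rewrite mulSn addnC subnDl.
by rewrite -modnDml IHd modnDml -[in RHS]modnDml -[in RHS]modnMml bk modnMml
           mul1n modnDml.
Qed.

Lemma midy_propertyP (b M d : nat) : 1 < b -> 1 < M -> coprime b M ->
  d %| mult_order b M ->
  midy_property b M d <->
  M * (b ^ (mult_order b M %/ d) - 1) %| b ^ mult_order b M - 1.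
Proof.
move=> b_gt1 M_gt1 co dvd_d; set n := mult_order b M; set k := n %/ d.
have b_gt0 := ltnW b_gt1; have M_gt0 := ltnW M_gt1.
have sumE x : unit_residue M x ->
    (b ^ k - 1 %| midy_sum b M d x) = (M * (b ^ k - 1) %| x * (b ^ n - 1)).
  case/and3P=> _ ltxM _; have [<- _] := digit_period b_gt1 co ltxM.
  rewrite dvdn_pmul2l // /dvdn /midy_sum -/n -/k block_sum_mod //.
  by rewrite [d * k]mulnC /k divnK.
split=> [midy | dvd x Ux].
  (* The unit 1 alone already gives the divisibility. *)
  have U1 : unit_residue M 1 by rewrite /unit_residue M_gt1 coprime1n.
  by have := midy 1 U1; rewrite sumE // mul1n.
by rewrite sumE // dvdn_mull.
Qed.

(** Modulo a divisor [q] of [c - 1], the quotient [(c ^ d - 1) / (c - 1)] is a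
    sum of [d] ones. *)
Lemma dvdn_geometric_quotient (c d q : nat) : 1 < c ->
  q %| c - 1 -> q * (c - 1) %| c ^ d - 1 -> q %| d.
Proof.
move=> c_gt1 q_c.
have c1 : c = 1 %[mod q] by apply/eqP; rewrite eqn_mod_dvd // ltnW.
have -> : c ^ d - 1 = (\sum_(i < d) c ^ i) * (c - 1).
  by rewrite !subn1 predn_exp mulnC.
rewrite dvdn_pmul2r ?subn_gt0 // /dvdn => /eqP sum0; rewrite -sum0 -modn_summ.
rewrite (eq_bigr (fun=> 1 %% q)) => [|i _]; last by rewrite -modnXm c1 modnXm exp1n.
by rewrite modn_summ sum1_card card_ord.
Qed.

(** Were the order [m] of [b] modulo [q] smaller than its order [n] modulo
    [N], cutting the period into blocks of length [m] would make [q] divide the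
    number [n / m] of blocks, hence [n], to which its multiple [N] is
    coprime. *)
Lemma midy_pseudoprime_order (b N q : nat) : 1 < b -> 1 < q -> q %| N ->
  midy_pseudoprime b N -> mult_order b N = mult_order b q.
Proof.
move=> b_gt1 q_gt1 qN [_ /andP[N_gt1 _] coNb coNn midy].
have b_gt0 := ltnW b_gt1.
have co : coprime b N by rewrite coprime_sym.
have coq : coprime b q by apply: coprime_dvdr co.
set n := mult_order b N in coNn midy *; set m := mult_order b q.
have [n_gt0 _ _] := mult_orderP co; rewrite -/n in n_gt0.
have [m_gt0 _ _] := mult_orderP coq; rewrite -/m in m_gt0.
have mn : m %| n.
  rewrite mult_order_dvd_subn1 //; apply: dvdn_trans qN _.
  by rewrite -mult_order_dvd_subn1.
have nE : n = m * (n %/ m) by rewrite mulnC divnK.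
have d_n : n %/ m %| n by rewrite {2}nE dvdn_mull.
have [d_gt1 | d_le1] := ltnP 1 (n %/ m); last first.
  have d1 : n %/ m = 1 by apply/eqP; rewrite eqn_leq d_le1 divn_gt0 // dvdn_leq.
  by rewrite nE d1 muln1.
have [_ _ /(midy_propertyP _ _ _ b_gt1 N_gt1 co d_n)] := midy _ d_gt1 d_n.
rewrite -/n divnA // mulKn // => dvd.
have qd : q %| n %/ m.
  apply: (dvdn_geometric_quotient (b ^ m)).
  - by rewrite -(exp1n m) ltn_exp2r.
  - by rewrite -mult_order_dvd_subn1.
  by rewrite -expnM -nE; apply: dvdn_trans dvd; apply: dvdn_mul.
have : q %| gcdn N n by rewrite dvdn_gcd qN (dvdn_trans qd).
by rewrite (eqP coNn) dvdn1 => /eqP q1; rewrite q1 in q_gt1.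
Qed.

Theorem theorem10 (b N l : nat) (p e : 'I_l -> nat)
    (hb : (1 < b)%N)
    (hp : forall i, prime (p i))
    (hinj : injective p)
    (he : forall i, (0 < e i)%N)
    (hN : N = (\prod_(i < l) p i ^ e i)%N)
    (hodd : odd N)
    (hcomp : composite N)
    (hcop : coprime N b) :
  midy_pseudoprime b N <-> (forall i, mult_order b N = mult_order b (p i)).
Proof.
have pN i : p i %| N.
  by rewrite hN (bigD1 i) //= dvdn_mulr // dvdn_exp.
split=> [psp i | ord_eq].
  exact: midy_pseudoprime_order hb (prime_gt1 (hp i)) (pN i) psp.
have b_gt0 := ltnW hb; have [N_gt1 _] := andP hcomp.
have co : coprime b N by rewrite coprime_sym.
have cop i : coprime b (p i) by apply: coprime_dvdr (pN i) co.
have [n_gt0 _ _] := mult_orderP co.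
split=> // [|d d_gt1 d_n].
  rewrite [X in coprime X _]hN; apply: coprime_prod_primes => // i.
  by rewrite gtnNdvd // (ord_eq i) mult_order_ltn.
split=> //; apply/midy_propertyP => //.
set k := mult_order b N %/ d.
have k_gt0 : 0 < k by rewrite divn_gt0 ?(ltnW d_gt1) //; apply: dvdn_leq.
have co_k : coprime N (b ^ k - 1).
  rewrite hN; apply: coprime_prod_primes => // i.
  by rewrite -mult_order_dvd_subn1 // -(ord_eq i) gtnNdvd // ltn_Pdiv.
rewrite Gauss_dvd // -mult_order_dvd_subn1 // dvdnn /=.
have -> : mult_order b N = k * d by rewrite divnK.
by rewrite expnM -{2}(exp1n d) subn_exp dvdn_mulr.
Qed.
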